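(* Let $X$ be a locally finite CW-complex, and let $X_1$ and $X_2$ be connected one-ended subcomplexes of $X$ such that $X_1\cup X_2=X$. If $K$ is a finite subcomplex of $X$ (possibly empty) such that $(X_1\cap X_2)-K$ has more than one unbounded component, then $X$ does not have pro-finite first homology at infinity. In particular, $X$ is not simply connected at infinity.
   Context: A subset of a locally finite CW-complex is unbounded if it is not contained in any finite subcomplex. A connected locally finite CW-complex is one-ended if for every finite subcomplex $K$ its complement has exactly one unbounded component. A space $X$ has pro-finite first homology at infinity if for any compact set $C\subseteq X$ there is a compact set $D\subseteq X$ (with $C\subseteq D$) such that the image of $H_1(X-D)\to H_1(X-C)$ induced by inclusion is finite (integer coefficients). A space $X$ is simply connected at infinity if for any compact set $C$ there is a compact set $D$ such that every loop in $X-D$ is homotopically trivial in $X-C$. *)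

(* Defs.v *)
From HB Require Import structures.
From mathcomp Require Import freeg.
From mathcomp Require Import all_boot all_order all_algebra.
From mathcomp Require Import all_classical all_reals all_analysis.

Set Implicit Arguments.
Unset Strict Implicit.
Unset Printing Implicit Defensive.

Import Order.TTheory GRing.Theory Num.Theory.
Import numFieldNormedType.Exports.

Local Open Scope classical_set_scope.
Local Open Scope ring_scope.

Definition disk (R : realType) (n : nat) : set 'rV[R]_n :=
  [set x | \sum_i x 0 i ^+ 2 <= 1].

Definition open_disk (R : realType) (n : nat) : set 'rV[R]_n :=
  [set x | \sum_i x 0 i ^+ 2 < 1].

Definition sphere (R : realType) (n : nat) : set 'rV[R]_n :=
  [set x | \sum_i x 0 i ^+ 2 = 1].

Arguments disk : clear implicits.
Arguments open_disk : clear implicits.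
Arguments sphere : clear implicits.

(* A CW structure on X given by characteristic maps.  Only the restriction of
   [char_map e] to the closed disk matters.  That it restricts to a
   homeomorphism from the open disk onto the open cell follows from the axioms,
   the disk being compact and X Hausdorff. *)
Record cw_structure (R : realType) (X : topologicalType) := CWStructure {
  cell : Type;
  cell_dim : cell -> nat;
  char_map : forall e : cell, 'rV[R]_(cell_dim e) -> X;
  cw_hausdorff : hausdorff_space X;
  char_map_continuous : forall e : cell,
    {within disk R (cell_dim e), continuous (@char_map e)};
  char_map_inj : forall e : cell,
    {in open_disk R (cell_dim e) &, injective (@char_map e)};
  cw_partition : partition [set: cell]
    (fun e => @char_map e @` open_disk R (cell_dim e)) [set: X];
  cw_closure_finite : forall e : cell, exists F : set cell,
    [/\ finite_set F,
        forall e' : cell, F e' -> (cell_dim e' < cell_dim e)%N &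
        @char_map e @` sphere R (cell_dim e) `<=`
          \bigcup_(e' in F) (@char_map e' @` open_disk R (cell_dim e'))];
  cw_weak_topology : forall A : set X,
    (forall e : cell, closed (A `&` (@char_map e @` disk R (cell_dim e)))) ->
    closed A
}.

Arguments char_map {R X} c e : rename.

Section CW.
Context (R : realType) (X : topologicalType) (S : cw_structure R X).

Definition open_cell (e : cell S) : set X :=
  char_map S e @` open_disk R (cell_dim e).

Definition closed_cell (e : cell S) : set X :=
  char_map S e @` disk R (cell_dim e).

Definition locally_finite : Prop :=
  forall x : X, exists2 U : set X,
    nbhs x U & finite_set [set e | U `&` open_cell e !=set0].

Definition subcomplex_on (F : set (cell S)) (A : set X) : Prop :=
  A = \bigcup_(e in F) open_cell e /\ (forall e, F e -> closed_cell e `<=` A).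

Definition subcomplex (A : set X) : Prop := exists F, subcomplex_on F A.

Definition finite_subcomplex (A : set X) : Prop :=
  exists2 F, finite_set F & subcomplex_on F A.

(* In what follows Y is a subcomplex, regarded as a CW-complex in its own
   right: its subcomplexes are the subcomplexes of X contained in Y. *)

Definition unbounded (Y A : set X) : Prop :=
  ~ exists K, [/\ finite_subcomplex K, K `<=` Y & A `<=` K].

Definition unbounded_component (Y A U : set X) : Prop :=
  (exists2 x, A x & U = connected_component A x) /\ unbounded Y U.

Definition one_ended (Y : set X) : Prop :=
  forall K, finite_subcomplex K -> K `<=` Y ->
    exists! U : set X, unbounded_component Y (Y `\` K) U.

End CW.

Definition std_simplex (R : realType) (n : nat) : set 'rV[R]_n.+1 :=
  [set t | (forall i, 0 <= t 0 i) /\ \sum_i t 0 i = 1].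

Arguments std_simplex : clear implicits.

Section Face.
Context (R : realType) (n : nat) (i : 'I_n.+2).

Definition face_row (t : 'rV[R]_n.+1) : 'rV[R]_n.+2 :=
  \row_j (if unlift i j is Some k then t 0 k else 0).

Lemma face_row_simplex (t : std_simplex R n) :
  face_row (\val t) \in std_simplex R n.+1.
Proof.
case: t => t /= /set_mem [t0 t1]; apply/mem_set; split.
  by move=> j; rewrite mxE; case: unliftP.
rewrite (bigD1_ord i) //= mxE unlift_none add0r -[RHS]t1.
by apply: eq_bigr => k _; rewrite mxE liftK.
Qed.

Definition face (t : std_simplex R n) : std_simplex R n.+1 :=
  exist _ (face_row (\val t)) (face_row_simplex t).

Lemma face_row_continuous : continuous face_row.
Proof.
move=> t A [P Pn PA].
pose Q (a : 'I_1) (k : 'I_n.+1) : set R := P a (lift i k).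
exists Q.
  by move=> a k; have := Pn a (lift i k); rewrite mxE liftK ord1.
move=> s Qs; apply: PA => a j.
have := Pn a j; rewrite !mxE; case: unliftP => [k ->|_].
  by move=> _; have := Qs a k; rewrite ord1.
exact: nbhs_singleton.
Qed.

Lemma face_continuous : continuous face.
Proof.
apply/continuousP => A [B oB <-].
have /continuousP/(_ _ oB) oB' := face_row_continuous.
by exists (face_row @^-1` B).
Qed.

HB.instance Definition _ := isContinuous.Build _ _ face face_continuous.

End Face.

Section Homology.
Context (R : realType) (X : topologicalType).

Definition singular_simplex (n : nat) : Type :=
  continuousType (std_simplex R n) X.

Definition singular_chain (n : nat) : Type :=
  {freeg (singular_simplex n) / int}.

Definition simplex_face (n : nat) (s : singular_simplex n.+1) (i : 'I_n.+2) :
  singular_simplex n := s \o @face R n i.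

Definition boundary (n : nat) : singular_chain n.+1 -> singular_chain n :=
  fglift (fun s => \sum_(i < n.+2) << (-1) ^+ i *g simplex_face s i >>).

(* The singular chains of the subspace A, as chains of X. *)
Definition chains_in (n : nat) (A : set X) : set (singular_chain n) :=
  [set c | forall s : singular_simplex n, s \in dom c -> range s `<=` A].

Definition cycles1 (A : set X) : set (singular_chain 1) :=
  [set z | @chains_in 1 A z /\ @boundary 0 z = 0].

Definition boundaries1 (A : set X) : set (singular_chain 1) :=
  [set @boundary 1 c | c in @chains_in 2 A].

(* H_1(A), as the set of cosets z + B_1(A) for z in Z_1(A). *)
Definition H1_class (A : set X) (z : singular_chain 1) :
    set (singular_chain 1) :=
  [set z' | boundaries1 A (z' - z)].

Definition H1 (A : set X) : set (set (singular_chain 1)) :=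
  [set H1_class A z | z in cycles1 A].

(* The map H_1(A) -> H_1(B) induced by an inclusion A `<=` B sends
   h = z + B_1(A) to h + B_1(B) = z + B_1(B). *)
Definition H1_incl (B : set X) (h : set (singular_chain 1)) :
    set (singular_chain 1) :=
  [set z' | exists2 z, h z & boundaries1 B (z' - z)].

End Homology.

Section AtInfinity.
Context (R : realType) (X : topologicalType).

Definition pro_finite_H1_at_infinity : Prop :=
  forall C : set X, compact C ->
    exists D : set X, [/\ compact D, C `<=` D &
      finite_set [set H1_incl (~` C) h | h in @H1 R X (~` D)]].

Definition loop_in (A : set X) (f : R -> X) : Prop :=
  [/\ {within `[0, 1], continuous f}, f 0 = f 1 & f @` `[0, 1] `<=` A].

Definition null_homotopic_in (A : set X) (f : R -> X) : Prop :=
  exists H : R * R -> X,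
    [/\ {within `[0, 1] `*` `[0, 1], continuous H},
        H @` (`[0, 1] `*` `[0, 1]) `<=` A,
        forall s, s \in `[0, 1] -> H (s, 0) = f s,
        forall s, s \in `[0, 1] -> H (s, 1) = f 0 &
        forall t, t \in `[0, 1] -> H (0, t) = f 0 /\ H (1, t) = f 0].

Definition simply_connected_at_infinity : Prop :=
  forall C : set X, compact C ->
    exists2 D : set X, compact D &
      forall f : R -> X, loop_in (~` D) f -> null_homotopic_in (~` C) f.

End AtInfinity.

(* Main.v *)
(* Let A be (X1 ∩ X2) - K, U one of its unbounded components and W := A - U; all
   three are unions of open cells, so K ∪ U and K ∪ W are closed by local
   finiteness.  Gluing copies of X1 - K and X2 - K indexed by the integers, where
   copy n of X1 meets copy n of X2 along U and copy n + 1 of X2 along W, gives an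
   infinite cyclic cover of X - K, hence a homomorphism H_1(X - K) -> Z.
   Concretely, a lift of a map f into X - K is an integer-valued function
   satisfying [is_lift]; on a compact convex domain a lift exists and is unique
   up to a constant, and the variation of lifts along edges kills boundaries.
   One-endedness yields, outside any given finite subcomplex, points u of U and
   w of W joined by a path in X1 and by a path in X2.  These form a loop on which
   the homomorphism takes the value 1, so that its multiples have pairwise
   distinct images in H_1(X - K) and it is not null-homotopic in X - K. *)

From HB Require Import structures.
Require Import Defs.
From mathcomp Require Import freeg.
From mathcomp Require Import all_boot all_order all_algebra.
From mathcomp Require Import all_classical all_reals all_analysis.
From mathcomp Require Import ring lra.

Set Implicit Arguments.
Unset Strict Implicit.
Unset Printing Implicit Defensive.

Import Order.TTheory GRing.Theory Num.Theory.
Import numFieldNormedType.Exports.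

Local Open Scope classical_set_scope.
Local Open Scope ring_scope.

(** * Lifts to the cyclic cover *)

(** The level set of [g a] is relatively open and closed in [A]. The target [Z] carries no topology,
    so the lemma serves for integer indices and for predicates alike. *)
Lemma locally_constant_connected (T : topologicalType) (Z : Type) (A : set T)
    (g : T -> Z) :
  connected A -> (forall t, A t -> \forall t' \near t, A t' -> g t' = g t) ->
  forall a b, A a -> A b -> g a = g b.
Proof.
move=> cA lc a b Aa Ab.
have AE t : A t -> nbhs t [set t' | A t' -> g t' = g t] by exact: lc.
suff E : A `&` [set t | g t = g a] = A.
  by have : A b by []; rewrite -E => -[_ ->].
apply: cA.
- by exists a; split.
- exists [set t | A t -> g t = g a]°; first exact: open_interior.
  rewrite eqEsubset; split=> t [At] /=.
    by move=> ga; split=> //; near do rewrite -ga; exact: AE.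
  by move=> /interior_subset /(_ At).
- exists (~` [set t | A t -> g t <> g a]°).
    by apply: open_closedC; exact: open_interior.
  rewrite eqEsubset; split=> t [At] /=.
    by move=> ga; split=> // /interior_subset /(_ At).
  move=> nI; split=> //; apply: contrapT => ga; apply: nI.
  by apply: filterS (AE t At) => t' /= h /h ->.
Unshelve. all: by end_near. Qed.

(** Convexity of [A]. *)
Definition segment_closed (R : realType) (V : lmodType R) (A : set V) : Prop :=
  forall x y t, A x -> A y -> 0 <= t <= 1 -> A (x + t *: (y - x)).

Lemma segment_closed_connected (R : realType) (V : normedModType R)
    (A : set V) : segment_closed A -> connected A.
Proof.
move=> sA; have [->|/set0P[c Ac]] := eqVneq A set0; first exact: connected0.
rewrite (_ : A = \bigcup_(x in A) ((fun t : R => c + t *: (x - c)) @` `[0, 1])).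
  apply: bigcup_connected.
    exists c => x Ax; exists 0; last by rewrite scale0r addr0.
    by rewrite /= in_itv/= lexx ler01.
  move=> x Ax; apply: connected_continuous_connected.
    exact: segment_connected.
  apply: continuous_subspaceT => t.
  by apply: cvgD; [exact: cvg_cst|exact: scalel_continuous].
rewrite eqEsubset; split=> [x Ax|x [y Ay] [t]].
  exists x => //; exists 1; first by rewrite /= in_itv/= lexx ler01.
  by rewrite scale1r addrC subrK.
by rewrite /= in_itv/= => t01 <-; exact: sA.
Qed.

Lemma within_continuous_near (T T' : topologicalType) (D : set T) (f : T -> T')
    (A : set T') (t : T) : {within D, continuous f} -> D t -> nbhs (f t) A ->
  \forall t' \near t, D t' -> A (f t').
Proof. by move=> /subspace_continuousP cf Dt; exact: cf. Qed.

Lemma within_continuous_near_notin (T T' : topologicalType) (D : set T)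
    (f : T -> T') (A : set T') (t : T) :
  {within D, continuous f} -> D t -> closed A -> ~ A (f t) ->
  \forall t' \near t, D t' -> ~ A (f t').
Proof.
move=> cf Dt cA nA; apply: (within_continuous_near (A := ~` A)) => //.
by apply: open_nbhs_nbhs; split => //; exact: closed_openC.
Qed.

Section Lifts.
Variables (X : topologicalType) (X1 X2 K U W : set X).

(** This is all that the cyclic cover needs: off [K], the sets [U] and [W] are disjoint, relatively
    closed, and cover the overlap of [X1] and [X2]. *)
Record split_along : Prop := SplitAlong {
  split_closed1 : closed X1;
  split_closed2 : closed X2;
  split_cover : X1 `|` X2 = [set: X];
  split_meet : X1 `&` X2 `<=` K `|` (U `|` W);
  split_closedU : closed (K `|` U);
  split_closedW : closed (K `|` W);
  split_disjoint : U `&` W `<=` K }.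

(** Away from [U] a sheet index grows by one on leaving [X1] for [X2]; subtracting [side] makes it
    locally constant there. *)
Definition side (x : X) : int := if `[< X1 x >] then 0 else 1.

(* [N t] is the index of the sheet of the cyclic cover over [f t], counted in X1
   if [f t] lies in X1 and in X2 otherwise: away from W, the copies of X1 and X2
   with the same index are glued; away from U, copy n of X1 is glued to copy
   n + 1 of X2. *)
Definition is_lift (T : topologicalType) (D : set T) (f : T -> X)
    (N : T -> int) : Prop :=
  forall t, D t ->
    (\forall t' \near t, D t' -> ~ W (f t') /\ N t' = N t) \/
    (\forall t' \near t, D t' ->
      ~ U (f t') /\ N t' - side (f t') = N t - side (f t)).

Lemma is_lift_comp (T T' : topologicalType) (D : set T) (D' : set T')
    (f : T -> X) (f' : T' -> X) (g : T' -> T) (N : T -> int) :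
  {within D', continuous g} -> (forall t, D' t -> D (g t)) ->
  (forall t, D' t -> f' t = f (g t)) ->
  is_lift D f N -> is_lift D' f' (N \o g).
Proof.
move=> cg Dg f'E lN t D't.
have [h|h] := lN (g t) (Dg _ D't); [left|right];
  apply: filterS (within_continuous_near cg D't h) => t' /= H D't';
  rewrite !f'E//; exact: H D't' (Dg _ D't').
Qed.

Hypothesis XS : split_along.

(** Here [f t] lies in exactly one of the closed sets [X1] and [X2], and avoiding the other one is
    an open condition. *)
Lemma side_near (T : topologicalType) (D : set T) (f : T -> X) (t : T) :
  {within D, continuous f} -> D t -> ~ K (f t) -> ~ U (f t) -> ~ W (f t) ->
  \forall t' \near t, D t' -> side (f t') = side (f t).
Proof.
move=> cf Dt nK nU nW; rewrite /side; case: (pselect (X1 (f t))) => h.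
  have n2 : ~ X2 (f t).
    by move=> h2; have [//|[]] := split_meet XS (conj h h2).
  have := within_continuous_near_notin cf Dt (split_closed2 XS) n2.
  apply: filterS => t' + Dt' => /(_ Dt') m2.
  have : [set: X] (f t') by [].
  by rewrite -(split_cover XS) => -[h'|//]; rewrite !asboolT.
have := within_continuous_near_notin cf Dt (split_closed1 XS) h.
by apply: filterS => t' + Dt' => /(_ Dt') m1; rewrite !asboolF.
Qed.

(** The difference of two lifts is locally constant. If they satisfy different alternatives at [t],
    then [f t] avoids both [U] and [W], so [side] is constant nearby and the alternatives agree. *)
Lemma is_lift_unique (T : topologicalType) (D : set T) (f : T -> X)
    (N N' : T -> int) :
  connected D -> {within D, continuous f} -> (forall t, D t -> ~ K (f t)) ->
  is_lift D f N -> is_lift D f N' ->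
  forall a b, D a -> D b -> N b - N a = N' b - N' a.
Proof.
move=> cD cf fK lN lN' a b Da Db.
suff : N a - N' a = N b - N' b.
  by move/eqP; rewrite -subr_eq0 => /eqP h; apply/eqP; rewrite -subr_eq0;
     apply/eqP; lra.
apply: (@locally_constant_connected _ _ D (fun t => N t - N' t)) => //= t Dt.
have [h|h] := lN t Dt; have [h'|h'] := lN' t Dt.
- by apply: filterS2 h h' => t' h h' Dt'; rewrite (h Dt').2 (h' Dt').2.
- have s := side_near cf Dt (fK _ Dt) (nbhs_singleton h' Dt).1
    (nbhs_singleton h Dt).1.
  apply: filterS3 h h' s => t' h h' s Dt'.
  by have [_] := h' Dt'; rewrite (h Dt').2 (s Dt') => /addIr ->.
- have s := side_near cf Dt (fK _ Dt) (nbhs_singleton h Dt).1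
    (nbhs_singleton h' Dt).1.
  apply: filterS3 h h' s => t' h h' s Dt'.
  by have [_] := h Dt'; rewrite (h' Dt').2 (s Dt') => /addIr ->.
- apply: filterS2 h h' => t' h h' Dt'.
  have [_ e] := h Dt'; have [_ e'] := h' Dt'; lra.
Qed.

End Lifts.

(** * Existence of lifts on compact convex domains *)

Lemma segment_closed_ball (R : realType) (V : normedModType R) (a : V) (d : R) :
  segment_closed [set z : V | `|a - z| < d].
Proof.
move=> x y t /= ax ay /andP[t0 t1].
have -> : a - (x + t *: (y - x)) = (1 - t) *: (a - x) + t *: (a - y).
  rewrite scalerBl scale1r -[RHS]addrA [- (t *: _) + _]addrC -scalerBr opprB.
  by rewrite [a - y + _]addrC addrA subrK opprD addrA -scalerN opprB.
apply: le_lt_trans (ler_normD _ _) _; rewrite !normrZ.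
rewrite !ger0_norm ?subr_ge0//.
have [->|tn] := eqVneq t 1; first by rewrite subrr mul0r add0r mul1r.
have t1' : 0 < 1 - t by rewrite subr_gt0 lt_neqAle tn.
have := ltW ay; nra.
Qed.

Lemma segment_closedI (R : realType) (V : lmodType R) (A B : set V) :
  segment_closed A -> segment_closed B -> segment_closed (A `&` B).
Proof. by move=> sA sB x y t [? ?] [? ?] t01; split; [exact: sA|exact: sB]. Qed.

Section LiftExistence.
Variables (X : topologicalType) (X1 X2 K U W : set X).
Hypothesis XS : split_along X1 X2 K U W.
Variables (R : realType) (V : normedModType R) (D : set V) (f : V -> X).
Hypotheses (cD : compact D) (sD : segment_closed D).
Hypotheses (cf : {within D, continuous f}) (fK : forall t, D t -> ~ K (f t)).

Let misses (A : set X) (d : R) (x : V) : Prop :=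
  forall y, D y -> `|x - y| < d -> ~ A (f y).

Lemma misses_near (A : set X) x : closed (K `|` A) -> D x -> ~ A (f x) ->
  exists2 e : R, 0 < e & misses A e x.
Proof.
move=> cA Dx nA.
have nKA : ~ (K `|` A) (f x) by case; [exact: fK|].
have /nbhs_normP[e e0 he] := within_continuous_near_notin cf Dx cA nKA.
by exists e => // y Dy xy fy; apply: (he y xy Dy); right.
Qed.

(** Off [K] the sets [U] and [W] are disjoint and relatively closed, so each point of [D] has a ball
    missing one of them; compactness makes the radius uniform. *)
Lemma lebesgue_number :
  exists2 d : R, 0 < d & forall x, D x -> misses W d x \/ misses U d x.
Proof.
have shrink A (e : R) x x' : misses A e x -> `|x - x'| < e / 2 ->
    misses A (e / 2) x'.
  move=> m xx' y Dy x'y; apply: m => //.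
  rewrite (splitr e) -(subrK x' x) -addrA.
  exact: le_lt_trans (ler_normD _ _) (ltrD xx' x'y).
have mono A (d e : R) x : d <= e -> misses A e x -> misses A d x.
  by move=> de m y Dy xy; apply: m => //; exact: lt_le_trans xy de.
have cov := (@compact_near_coveringP _ D).1 cD R (0:R)^'+
  (fun d x => misses W d x \/ misses U d x) _.
have h : \forall d \near (0:R)^'+,
    D `<=` (fun x => misses W d x \/ misses U d x).
  apply: cov => x Dx.
  have [e e0 he] : exists2 e : R, 0 < e & misses W e x \/ misses U e x.
    have [Wx|nW] := pselect (W (f x)).
      have nU : ~ U (f x).
        by move=> Ux; exact: fK Dx (split_disjoint XS (conj Ux Wx)).
      have [e e0 h] := misses_near (split_closedU XS) Dx nU.
      by exists e => //; right.
    have [e e0 h] := misses_near (split_closedW XS) Dx nW.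
    by exists e => //; left.
  (* Halving [e] keeps the ball of radius [e / 2] around any [x'] this close inside the ball of
     radius [e] around [x]. *)
  exists ([set x' | `|x - x'| < e / 2], [set d | d < e / 2]) => /=.
    split; first by apply/nbhs_normP; exists (e / 2) => //; rewrite /= divr_gt0.
    by apply: nbhs_right_lt; rewrite divr_gt0.
  case=> x' d /= [xx' de]; case: he => h; [left|right];
    exact: mono (ltW de) (shrink _ _ _ _ h xx').
near (0:R)^'+ => d; exists d; first by near: d; exact: nbhs_right_gt.
by near: d; exact: h.
Unshelve. all: by end_near. Qed.

Lemma is_lift_exists : exists N, is_lift X1 U W D f N.
Proof.
have [D0|/set0P[c Dc]] := eqVneq D set0.
  by exists (fun=> 0) => t; rewrite D0.
have [d d0 dP] := lebesgue_number.
(* [a x y] is the variation of a lift between nearby points; a lift is obtained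
   by summing it along the segment from [c] to [x], cut into [M] pieces. *)
pose a (x y : V) : int :=
  if `[< misses W d x >] then 0 else side X1 (f y) - side X1 (f x).
(* The part of [D] within [d] of both [x] and [y] is convex and avoids both [U] and [W], so [side]
   is constant on it. *)
have side_eq x y z : D x -> D y -> D z -> misses W d x -> misses U d y ->
    `|x - y| < d -> `|x - z| < d -> `|y - z| < d ->
    side X1 (f y) = side X1 (f z).
  move=> Dx Dy Dz mW mU xy xz yz.
  pose B := D `&` ([set z | `|x - z| < d] `&` [set z | `|y - z| < d]).
  have sB : segment_closed B.
    apply: segment_closedI => //; apply: segment_closedI;
      exact: segment_closed_ball.
  have BD : B `<=` D by move=> ? [].
  apply: (@locally_constant_connected _ _ B (fun z => side X1 (f z))).
  - exact: segment_closed_connected.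
  - move=> t [Dt [xt yt]].
    have := side_near XS cf Dt (fK Dt) (mU _ Dt yt) (mW _ Dt xt).
    by apply: filterS => t' h Bt'; apply: h; exact: BD.
  - by split => //; split => //=; rewrite subrr normr0.
  - by split.
(* This is the cocycle identity on small triangles. Only the cases where [x] and [y] fall under
   different alternatives need [side_eq]. *)
have aD x y z : D x -> D y -> D z ->
    `|x - y| < d -> `|x - z| < d -> `|y - z| < d -> a x y + a y z = a x z.
  move=> Dx Dy Dz xy xz yz; rewrite /a.
  case: asboolP => mx; case: asboolP => my.
  - by rewrite addr0.
  - have [//|mU] := dP y Dy.
    by rewrite (side_eq x y z)// subrr addr0.
  - have [//|mU] := dP x Dx; rewrite addr0.
    by rewrite -(side_eq y x y)// ?(side_eq y x z)// ?subrr ?normr0// distrC.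
  - by rewrite addrC addrA subrK.
have axx x : a x x = 0 by rewrite /a subrr if_same.
have [M [m0 MP]] : exists M : nat, (0 < M)%N /\
    forall x, D x -> `|x - c| / M%:R < d / 3.
  have /ex_strict_bound_gt0[B B0 BP] := compact_bounded cD.
  (* Since [B] bounds the norm on [D], segments from [c] have length at most [2 * B]; this many
     pieces are each shorter than [d / 3]. *)
  pose M := (Num.bound ((2 * B) / (d / 3))).+1.
  exists M; split=> // x Dx.
  have hM : (2 * B) / (d / 3) < M%:R.
    apply: lt_le_trans (_ : (Num.bound ((2 * B) / (d / 3)))%:R <= _).
      by apply: archi_boundP; rewrite !divr_ge0// ?mulr_ge0// ltW.
    by rewrite ler_nat.
  rewrite ltr_pdivrMr ?ltr0n// mulrC -ltr_pdivrMr ?divr_gt0//.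
  apply: le_lt_trans hM; rewrite ler_pM2r ?invr_gt0 ?divr_gt0//.
  have := ler_normB x c; have := BP _ Dx; have := BP _ Dc => /=; lra.
pose p (x : V) (k : nat) : V := c + (k%:R / M%:R) *: (x - c).
have kM k : (k <= M)%N -> 0 <= (k%:R / M%:R : R) <= 1.
  move=> kM; rewrite divr_ge0//= ler_pdivrMr ?ltr0n// mul1r ler_nat//.
have Dp x k : D x -> (k <= M)%N -> D (p x k).
  by move=> Dx /kM t01; exact: sD Dc Dx t01.
have pS x k : D x -> `|p x k - p x k.+1| < d / 3.
  move=> Dx; rewrite /p opprD addrACA subrr add0r -scalerBl -mulrBl.
  rewrite -natr1 opprD addrA subrr add0r mulN1r normrZ normrN.
  rewrite ger0_norm ?invr_ge0//.
  by rewrite mulrC; exact: MP.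
have pp x y k : (k <= M)%N -> `|p x k - p y k| <= `|x - y|.
  move=> /kM /andP[k0 k1]; rewrite /p opprD addrACA subrr add0r -scalerBr.
  rewrite opprB addrA subrK normrZ ger0_norm//.
  by rewrite ler_piMl.
pose N x : int := \sum_(k < M) a (p x k) (p x k.+1).
(* The two subdivided segments form a ladder starting at the common point [c]. Each of its
   quadrilaterals has sides below [d / 3], so a diagonal cuts it into two triangles to which [aD]
   applies. *)
have NE x y : D x -> D y -> `|x - y| < d / 3 -> N y - N x = a x y.
  move=> Dx Dy xy.
  have pM z : p z M = z.
    by rewrite /p divff ?scale1r ?pnatr_eq0 -?lt0n// addrC subrK.
  have p0 z : p z 0 = c by rewrite /p mul0r scale0r addr0.
  suff : forall k, (k <= M)%N -> \sum_(i < k) a (p y i) (p y i.+1) -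
      \sum_(i < k) a (p x i) (p x i.+1) = a (p x k) (p y k).
    by move=> /(_ M (leqnn _)); rewrite !pM.
  elim=> [_|k IH kM'].
    by rewrite !big_ord0 !p0 axx subrr.
  rewrite !big_ord_recr /= opprD addrACA IH ?(ltnW kM')//.
  have dx := pS x k Dx; have dy := pS y k Dy.
  have dk := le_lt_trans (pp x y k (ltnW kM')) xy.
  have dk1 := le_lt_trans (pp x y k.+1 kM') xy.
  have Dxk := Dp x k Dx (ltnW kM'); have Dyk := Dp y k Dy (ltnW kM').
  have Dxk1 := Dp x k.+1 Dx kM'; have Dyk1 := Dp y k.+1 Dy kM'.
  have dd : `|p x k - p y k.+1| < d.
    rewrite -(subrK (p y k) (p x k)) -addrA.
    by apply: le_lt_trans (ler_normD _ _) _; lra.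
  have e1 := aD (p x k) (p y k) (p y k.+1) Dxk Dyk Dyk1 _ dd _.
  have e2 := aD (p x k) (p x k.+1) (p y k.+1) Dxk Dxk1 Dyk1 _ dd _.
  have d3 z : z < d / 3 -> z < d by lra.
  rewrite addrA e1 ?d3// -e2 ?d3//.
  by rewrite addrC addrA addNr add0r.
have d30 : 0 < d / 3 by rewrite divr_gt0.
exists N => t Dt.
have nearN : \forall t' \near t, D t' -> N t' - N t = a t t'.
  by apply/nbhs_normP; exists (d / 3) => // t' tt' Dt'; exact: NE.
have near_d : \forall t' \near t, `|t - t'| < d by apply/nbhs_normP; exists d.
have [mW|nW] := pselect (misses W d t); [left|right];
    apply: filterS2 nearN near_d => t' + tt' Dt' => /(_ Dt').
  rewrite /a asboolT// => /eqP; rewrite subr_eq0 => /eqP ->; split=> //.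
  exact: mW.
rewrite /a asboolF// => e; split; last by lra.
by have [//|mU] := dP t Dt; exact: mU.
Qed.

End LiftExistence.
(** * Winding of singular chains and of loops *)

Lemma connected_setT_subtype (T : topologicalType) (A : set T) :
  connected A -> connected [set: A].
Proof.
move=> cA; have [A0|/set0P[x0 Ax0]] := eqVneq A set0.
  rewrite (_ : [set: A] = set0); first exact: connected0.
  have nA y : ~ A y by rewrite A0.
  by rewrite -subset0 => x _; case: (nA _ (set_valP x)).
pose x1 : A := exist _ x0 (mem_set Ax0).
(* The identity of the subtype, extended outside [A] by the default [x1], is continuous on [A] and
   maps [A] onto the subtype. *)
have <- : valL_ x1 (fun x : A => x) @` A = [set: A].
  rewrite -subTset => x _; exists (\val x); first exact: set_valP.
  exact: (congr1 (fun g => g x) (valLK x1 (fun x : A => x))).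
apply: connected_continuous_connected => //.
by apply/subspace_valL_continuousP' => x.
Qed.

Section Simplex.
Context (R : realType).

Lemma sum_coord_continuous n (g : R -> R) : continuous g ->
  continuous (fun x : 'rV[R]_n => \sum_i g (x 0 i)).
Proof.
move=> cg; apply: continuous_big => [|i _].
  by move=> x; apply: cvgD; [exact: cvg_fst|exact: cvg_snd].
by move=> x; apply: continuous_comp; [exact: coord_continuous|exact: cg].
Qed.

Lemma compact_std_simplex n : compact (std_simplex R n).
Proof.
have cB := @rV_compact R n.+1 (fun=> `[0, 1]%classic)
  (fun=> @segment_compact R 0 1).
apply: (subclosed_compact _ cB).
- have -> : std_simplex R n = \bigcap_(i in [set: 'I_n.+1]) [set t | 0 <= t 0 i]
      `&` [set t | \sum_i t 0 i = 1].
    rewrite eqEsubset; split=> t [t0 t1]; split=> // i; last exact: t0.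
    by move=> _; exact: t0.
  apply: closedI.
    apply: closed_bigI => i _.
    apply: (@closed_comp _ _ (fun t : 'rV[R]_n.+1 => t 0 i) [set x | 0 <= x]).
      by move=> t _; exact: coord_continuous.
    exact: closed_ge.
  apply: (@closed_comp _ _ (fun t : 'rV[R]_n.+1 => \sum_i t 0 i)
    [set x | x = 1]).
    by move=> t _; apply: (@sum_coord_continuous _ id) => x; exact: cvg_id.
  exact: closed_eq.
- move=> t [t0 t1] i /=; rewrite in_itv/= t0/= -t1 (bigD1 i)//= lerDl.
  by apply: sumr_ge0 => j _.
Qed.

Lemma simplex_coord_continuous n (i : 'I_n.+1) :
  continuous (fun t : std_simplex R n => \val t 0 i).
Proof.
move=> t; apply: (@continuous_comp _ _ _ (fun t : std_simplex R n => \val t)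
  (fun v => v 0 i)).
  exact: initial_continuous.
exact: coord_continuous.
Qed.

Lemma segment_closed_std_simplex n : segment_closed (std_simplex R n).
Proof.
move=> x y t [x0 x1] [y0 y1] /andP[t0 t1]; split.
  move=> i; rewrite !mxE; have := x0 i; have := y0 i; nra.
under eq_bigr => i _ do rewrite !mxE.
by rewrite big_split /= -mulr_sumr sumrB x1 y1 subrr mulr0 addr0.
Qed.

Lemma vertex_subproof n (i : 'I_n.+1) :
  (delta_mx 0 i : 'rV[R]_n.+1) \in std_simplex R n.
Proof.
apply/mem_set; split=> [j|]; first by rewrite mxE; case: (_ && _).
rewrite (bigD1 i)//= big1 ?mxE ?eqxx ?addr0// => j ji.
by rewrite mxE (negPf ji) andbF.
Qed.

Definition vertex n (i : 'I_n.+1) : std_simplex R n :=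
  exist _ (delta_mx 0 i) (vertex_subproof i).

Lemma face_vertex n (i : 'I_n.+2) (j : 'I_n.+1) :
  face i (vertex j) = vertex (lift i j).
Proof.
apply: val_inj; apply/rowP => k; rewrite !mxE.
case: unliftP => [l ->|->]; rewrite ?mxE ?eqxx/=.
  by rewrite (inj_eq lift_inj).
by rewrite eq_liftF.
Qed.

End Simplex.

HB.instance Definition _ (R : realType) (X : topologicalType) (n : nat) :=
  GRing.isZmodMorphism.Build _ _ (@boundary R X n) (lift_is_additive _).

Lemma boundaryU (R : realType) (X : topologicalType) (n : nat) k
    (s : singular_simplex R X n.+1) :
  boundary << k *g s >> =
  k *: \sum_(i < n.+2) << (-1) ^+ i *g simplex_face s i >>.
Proof. exact: liftU. Qed.

Section Winding.
Context (R : realType).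
Variables (X : topologicalType) (X1 X2 K U W : set X).
Hypothesis XS : split_along X1 X2 K U W.

(** The simplex is a subtype, whereas lifts were built on subsets of a normed space; [s] is
    therefore extended by a default value and the lift is pulled back. *)
Lemma is_lift_simplex n (s : singular_simplex R X n) :
  range s `<=` ~` K -> exists N, is_lift X1 U W [set: std_simplex R n] s N.
Proof.
move=> sK; pose f := valL_ (s (vertex R ord0)) s.
have fE (x : std_simplex R n) : f (\val x) = s x.
  exact: (congr1 (fun g => g x) (valLK (s (vertex R ord0)) s)).
have [|t /= Dt Kt|N lN] := is_lift_exists XS (@compact_std_simplex R n)
  (@segment_closed_std_simplex R n) (f := f).
- exact/subspace_valL_continuousP'/cts_fun.
- apply: (sK (f t)) => //; exists (exist _ t (mem_set Dt)) => //.
  by rewrite -fE.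
exists (N \o \val); apply: is_lift_comp lN.
- by apply: continuous_subspaceT; exact: initial_continuous.
- by move=> t _; exact: set_valP.
- by move=> t _; rewrite fE.
Qed.

(** For a simplex avoiding [K] a lift exists and its variation does not depend on the choice; 0 is a
    default value. The type [int^o] is the integers as a module over themselves, as [fglift]
    requires. *)
Definition winding (s : singular_simplex R X 1) : int^o :=
  if pselect (exists N, is_lift X1 U W [set: std_simplex R 1] s N) is left h
  then let N := projT1 (cid h) in N (vertex R ord_max) - N (vertex R ord0)
  else 0.

Lemma windingE (s : singular_simplex R X 1) N : range s `<=` ~` K ->
  is_lift X1 U W [set: std_simplex R 1] s N ->
  winding s = N (vertex R ord_max) - N (vertex R ord0).
Proof.
move=> sK lN; rewrite /winding; case: pselect => [h|[]]; last by exists N.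
case: cid => N' lN' /=; apply: (is_lift_unique XS _ _ _ lN' lN) => //.
- apply: connected_setT_subtype; apply: segment_closed_connected.
  exact: segment_closed_std_simplex.
- exact/continuous_subspaceT/cts_fun.
- by move=> t _; apply: sK.
Qed.

Definition chain_winding : singular_chain R X 1 -> int^o := fglift winding.

HB.instance Definition _ := GRing.isZmodMorphism.Build _ _ chain_winding
  (lift_is_additive winding).

Lemma chain_windingU k s : chain_winding << k *g s >> = k * winding s.
Proof. exact: liftU. Qed.

(** A lift over the triangle restricts to lifts over its three edges, and the alternating sum of
    variations cancels vertex by vertex. *)
Lemma winding_faces (s : singular_simplex R X 2) : range s `<=` ~` K ->
  \sum_(i < 3) (-1) ^+ i * winding (simplex_face s i) = 0.
Proof.
move=> sK; have [N lN] := is_lift_simplex sK.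
have wE i : winding (simplex_face s i) =
    N (vertex R (lift i ord_max)) - N (vertex R (lift i ord0)).
  rewrite -!face_vertex; apply: (windingE (N := N \o face i)).
    by move=> _ [t _ <-]; apply: sK; exists (face i t).
  apply: is_lift_comp lN => //.
  exact/continuous_subspaceT/face_continuous.
rewrite !big_ord_recr big_ord0 /= !wE add0r expr0 expr1 sqrrN expr1n.
have -> : lift (widen_ord (leqnSn 2) (widen_ord (leqnSn 1) ord_max)) ord_max
  = ord_max :> 'I_3 by apply/val_inj.
have -> : lift (widen_ord (leqnSn 2) (widen_ord (leqnSn 1) ord_max)) ord0
  = lift ord_max ord_max :> 'I_3 by apply/val_inj.
have -> : lift (widen_ord (leqnSn 2) ord_max) ord_max
  = ord_max :> 'I_3 by apply/val_inj.
have -> : lift (widen_ord (leqnSn 2) ord_max) ord0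
  = ord0 :> 'I_3 by apply/val_inj.
have -> : lift ord_max ord0 = ord0 :> 'I_3 by apply/val_inj.
ring.
Qed.

Lemma chain_winding_boundary (A : set X) z : A `<=` ~` K ->
  boundaries1 A z -> chain_winding z = 0.
Proof.
move=> AK [c cA <-]; rewrite -(freeg_sumE c) !raddf_sum big_seq.
apply: big1 => s sc; rewrite /= boundaryU -[coeff s c]intz scaler_int raddfMz.
rewrite raddf_sum.
under eq_bigr => i _ do rewrite /= chain_windingU.
rewrite (winding_faces (subset_trans (cA s sc) AK)) mul0rz //.
Qed.

(** Equality of the two images writes [z - z'] as a boundary in [B] plus a boundary in [A], and both
    have winding 0. *)
Lemma H1_incl_chain_winding (A B : set X) z z' : A `<=` B -> B `<=` ~` K ->
  H1_incl B (H1_class A z) = H1_incl B (H1_class A z') ->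
  chain_winding z = chain_winding z'.
Proof.
move=> AB BK e; have AK := subset_trans AB BK.
have b0 C (y : singular_chain R X 1) : boundaries1 C (y - y).
  by exists 0; [move=> s; rewrite dom0|rewrite raddf0 subrr].
have : H1_incl B (H1_class A z) z by exists z; exact: b0.
rewrite e => -[y yz' zy]; apply/eqP; rewrite -subr_eq0 -raddfB.
rewrite -(subrK y z) -addrA raddfD /=.
by rewrite (chain_winding_boundary BK zy) (chain_winding_boundary AK yz').
Qed.

End Winding.

(** * Loops of winding number one as obstructions at infinity *)

Section Obstruction.
Context (R : realType).
Variables (X : topologicalType) (X1 X2 K U W : set X).
Hypothesis XS : split_along X1 X2 K U W.

Local Notation I01 := (`[0, 1]%classic : set R).

(** Along a constant map the [side] terms cancel, so both alternatives make the lift locally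
    constant. *)
Lemma is_lift_cst (T : topologicalType) (D : set T) (f : T -> X) N x :
  connected D -> (forall t, D t -> f t = x) -> is_lift X1 U W D f N ->
  forall a b, D a -> D b -> N a = N b.
Proof.
move=> cD fx lN; apply: locally_constant_connected => // t Dt.
have [h|h] := lN t Dt; apply: filterS h => t' h Dt'; first by have [] := h Dt'.
by have [_] := h Dt'; rewrite !fx// => /addIr.
Qed.

(** The loop is a map of the whole line, continuous with values in [A] everywhere; only the lift is
    confined to the unit interval. *)
Definition winding_loop (A : set X) (f : R -> X) : Prop :=
  [/\ continuous f, forall t, A (f t), f 0 = f 1 &
    exists2 N, is_lift X1 U W I01 f N & N 1 - N 0 = 1].

Lemma compact_segment_setX : compact (I01 `*` I01 : set (R * R)).
Proof. by apply: compact_setX; exact: segment_compact. Qed.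

Lemma segment_closed_itv : segment_closed I01.
Proof.
move=> x y t /=; rewrite !in_itv/= => /andP[x0 x1] /andP[y0 y1] /andP[t0 t1].
by rewrite /GRing.scale/=; apply/andP; split; nra.
Qed.

Lemma segment_closed_setX :
  segment_closed (I01 `*` I01 : set (R * R)).
Proof.
move=> x y t [x1 x2] [y1 y2] t01; split; exact: segment_closed_itv.
Qed.

(** A lift over the homotopy square would vary by 1 along the bottom edge, yet by 0 along the other
    three edges, where the homotopy is constant. *)
Lemma winding_loop_not_null_homotopic f :
  winding_loop (~` K) f -> ~ null_homotopic_in (~` K) f.
Proof.
move=> [cf fK f01 [N lN N1]] [H [cH HK H0 H1 Hs]].
have [|M lM] := is_lift_exists XS compact_segment_setX segment_closed_setX cH.
  by move=> p Ip Kp; apply: (HK (H p)) Kp; exists p.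
have cI : connected I01 by exact: segment_connected.
have I0 : I01 (0 : R) by rewrite /= in_itv/= lexx ler01.
have I1 : I01 (1 : R) by rewrite /= in_itv/= lexx ler01.
have edge (g : R -> R * R) h : continuous g ->
    (forall t, I01 t -> (I01 `*` I01) (g t)) ->
    (forall t, I01 t -> h t = H (g t)) ->
    is_lift X1 U W I01 h (M \o g).
  move=> cg gI hE; apply: is_lift_comp lM => //.
  exact: continuous_subspaceT.
have cl (c : R) : continuous (fun t : R => (t, c)).
  by move=> t; exact: (cvg_pair cvg_id (cvg_cst c)).
have cr (c : R) : continuous (fun t : R => (c, t)).
  by move=> t; exact: (cvg_pair (cvg_cst c) cvg_id).
have e0 : is_lift X1 U W I01 f (M \o (fun t => (t, 0))).
  by apply: edge => // t It; rewrite H0 ?inE.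
have e1 : is_lift X1 U W I01 (fun=> f 0) (M \o (fun t => (t, 1))).
  by apply: edge => // t It; rewrite H1 ?inE.
have el : is_lift X1 U W I01 (fun=> f 0) (M \o (fun t => (0, t))).
  by apply: edge => // t It; have [|-> _] := Hs t; rewrite ?inE.
have er : is_lift X1 U W I01 (fun=> f 0) (M \o (fun t => (1, t))).
  by apply: edge => // t It; have [|_ ->] := Hs t; rewrite ?inE.
have := is_lift_unique XS cI (continuous_subspaceT cf) (fun t _ => fK t) e0 lN
  I0 I1.
have /= -> := is_lift_cst cI (fun t _ => erefl) el I0 I1.
have /= -> := is_lift_cst cI (fun t _ => erefl) er I0 I1.
have /= -> := is_lift_cst cI (fun t _ => erefl) e1 I0 I1.
by rewrite subrr N1.
Qed.

Lemma winding_loop_not_simply_connected_at_infinity : compact K ->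
  (forall D, compact D -> exists f, winding_loop (~` (D `|` K)) f) ->
  ~ simply_connected_at_infinity R X.
Proof.
move=> cK loops sc; have [D cD hD] := sc K cK.
have [f [cf fA f01 hN]] := loops D cD.
apply: (@winding_loop_not_null_homotopic f).
  by split => // t Kt; apply: (fA t); right.
apply: hD; split => //; first exact: continuous_subspaceT.
by move=> _ [t _ <-] Dt; apply: (fA t); left.
Qed.

(** The last barycentric coordinate identifies the 1-simplex with the unit interval, sending
    [vertex R ord0] to 0 and [vertex R ord_max] to 1. *)
Definition loop_simplex (f : R -> X) (t : std_simplex R 1) : X :=
  f (\val t 0 ord_max).

Lemma loop_simplex_continuous f : continuous f -> continuous (loop_simplex f).
Proof.
move=> cf t.
apply: (@continuous_comp _ _ _ (fun t : std_simplex R 1 => \val t 0 ord_max) f).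
  exact: simplex_coord_continuous.
exact: cf.
Qed.

Lemma winding_loop_simplex f A : A `<=` ~` K -> winding_loop A f ->
  exists s : singular_simplex R X 1,
    [/\ range s `<=` A, simplex_face s ord0 = simplex_face s ord_max &
        winding X1 U W s = 1].
Proof.
move=> AK [cf fA f01 [N lN N1]].
pose s : singular_simplex R X 1 :=
  HB.pack (loop_simplex f)
    (isContinuous.Build _ _ _ (loop_simplex_continuous cf)).
have sA : range s `<=` A by move=> _ [t _ <-]; exact: fA.
exists s; split => //.
  (* The face opposite [ord0] is the point [f 1], the face opposite [ord_max] is [f 0], and the loop
     closes up. *)
  apply/continuousEP => t; rewrite /= /loop_simplex /face /= !mxE.
  have [t0 t1] := set_valP t.
  have tE : \val t 0 ord0 = 1 by rewrite -t1 big_ord1.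
  rewrite (_ : unlift ord_max ord_max = None); last by rewrite unlift_none.
  case: unliftP => [k _|//]; rewrite (ord1 k) tE; exact: esym.
pose g (t : std_simplex R 1) : R := \val t 0 ord_max.
rewrite (windingE XS (subset_trans sA AK) (N := N \o g)).
  by rewrite /= /g !mxE /= N1.
apply: is_lift_comp lN => //.
  by apply: continuous_subspaceT; exact: simplex_coord_continuous.
move=> t _; have [t0 t1] := set_valP t; rewrite /= in_itv/= /g t0 -t1.
by rewrite (bigD1 ord_max)//= lerDl; apply: sumr_ge0 => j _.
Qed.

(** With [C := K], the multiples of one loop outside [D] are cycles with distinct windings, so their
    images in the homology of the complement of [K] are infinitely many. *)
Lemma winding_loop_not_pro_finite_H1_at_infinity : compact K ->
  (forall D, compact D -> exists f, winding_loop (~` (D `|` K)) f) ->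
  ~ pro_finite_H1_at_infinity R X.
Proof.
move=> cK loops pf; have [D [cD KD fin]] := pf K cK.
have [f hf] := loops D cD; rewrite (setUidl KD) in hf.
have DK : ~` D `<=` ~` K by exact: subsetC.
have [s [sA s01 ws]] := winding_loop_simplex DK hf.
(* The coefficient starts at 1, so that the support of [z n] is always exactly [s]. *)
pose z (n : nat) : singular_chain R X 1 := << n.+1%:Z *g s >>.
have zc n : cycles1 (~` D) (z n).
  split; first by move=> t; rewrite domU// inE => /eqP ->.
  rewrite /z boundaryU !big_ord_recr big_ord0 /= add0r.
  rewrite (_ : widen_ord _ _ = ord0); last exact: val_inj.
  by rewrite s01 freegUD addrN freegU0 scaler0.
pose F n := H1_incl (~` K) (H1_class (~` D) (z n)).
have Finj : injective F.
  move=> m n /(H1_incl_chain_winding XS DK (fun _ => id)).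
  by rewrite !chain_windingU ws !mulr1 => -[].
have := finite_preimage (f := F) (fun m n _ _ => @Finj m n) fin.
rewrite (_ : F @^-1` _ = [set: nat]); first exact: infinite_nat.
rewrite -subTset => n _ /=; exists (H1_class (~` D) (z n)) => //.
by exists (z n).
Qed.

End Obstruction.

(** * Paths, and a loop of winding number one built from two paths *)

Section Paths.
Context (R : realType) (X : topologicalType).

Definition concat (p q : R -> X) (t : R) : X :=
  if t <= 2^-1 then p (2 * t) else q (2 * t - 1).

Lemma concat_continuous (p q : R -> X) :
  continuous p -> continuous q -> p 1 = q 0 -> continuous (concat p q).
Proof.
move=> cp cq pq; apply/continuous_subspace_setT.
have -> : [set: R] = [set t | t <= 2^-1] `|` [set t | 2^-1 <= t].
  apply/esym; rewrite -subTset => t _ /=.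
  by case: (leP t 2^-1) => [|/ltW]; [left|right].
apply: withinU_continuous; [exact: closed_le|exact: closed_ge| |].
- have E : {in [set t : R | t <= 2^-1], (fun t => p (2 * t)) =1 concat p q}.
    by move=> t; rewrite inE /= /concat => ->.
  apply: (subspace_eq_continuous E); apply: continuous_subspaceT => t.
  apply: (@continuous_comp _ _ _ (fun t : R => 2 * t)); last exact: cp.
  exact: mulrl_continuous.
- have E : {in [set t : R | 2^-1 <= t], (fun t => q (2 * t - 1)) =1 concat p q}.
    move=> t; rewrite inE /= /concat => h; case: ifPn => // h'.
    have -> : t = 2^-1 by apply/eqP; rewrite eq_le h h'.
    by rewrite mulfV ?subrr// pnatr_eq0.
  apply: (subspace_eq_continuous E); apply: continuous_subspaceT => t.
  apply: (@continuous_comp _ _ _ (fun t : R => 2 * t - 1)); last exact: cq.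
  by apply: cvgB; [exact: mulrl_continuous|exact: cvg_cst].
Qed.

Lemma concat0 p q : concat p q 0 = p 0.
Proof. by rewrite /concat mulr0 invr_ge0 ler0n. Qed.

Lemma concat1 p q : concat p q 1 = q 1.
Proof.
by rewrite /concat; case: ifPn => [h|_]; [exfalso; lra|congr q; ring].
Qed.

Definition joined (A : set X) (x y : X) : Prop :=
  exists g : R -> X, [/\ continuous g, forall t, A (g t), g 0 = x & g 1 = y].

Lemma joined_refl (A : set X) x : A x -> joined A x x.
Proof. by move=> Ax; exists (fun=> x); split=> // t; exact: cvg_cst. Qed.

Lemma joined_sym (A : set X) x y : joined A x y -> joined A y x.
Proof.
move=> [g [cg gA g0 g1]]; exists (fun t => g (1 - t)); split=> //.
- move=> t.
  apply: (@continuous_comp _ _ _ (fun t : R => 1 - t)); last exact: cg.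
  by apply: cvgB; [exact: cvg_cst|exact: cvg_id].
- by rewrite subr0.
- by rewrite subrr.
Qed.

Lemma joined_trans (A : set X) x y z :
  joined A x y -> joined A y z -> joined A x z.
Proof.
move=> [g [cg gA g0 g1]] [h [ch hA h0 h1]]; exists (concat g h); split.
- by apply: concat_continuous => //; rewrite g1 h0.
- by move=> t; rewrite /concat; case: ifP.
- by rewrite concat0.
- by rewrite concat1.
Qed.

Variables (X1 X2 K U W : set X).
Hypothesis XS : split_along X1 X2 K U W.

(** The loop runs from [u] to [w] in copy 0 of [X1], passes at [w] into copy 1 of [X2], and returns
    there to [u], where copy 1 of [X2] is glued to copy 1 of [X1]. *)
Lemma joined_winding_loop (A : set X) u w : A `<=` ~` K ->
  U `<=` X1 -> W `<=` X1 -> U u -> W w ->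
  joined (X1 `&` A) u w -> joined (X2 `&` A) w u ->
  exists f : R -> X, winding_loop X1 U W A f.
Proof.
move=> AK UX1 WX1 Uu Ww [p [cp pA p0 p1]] [q [cq qA q0 q1]].
pose f := concat p q.
have cf : continuous f by apply: concat_continuous; rewrite // p1.
have fA t : A (f t).
  rewrite /f /concat; case: ifP => _; first by have [] := pA (2 * t).
  by have [] := qA (2 * t - 1).
have fX1 t : t <= 2^-1 -> X1 (f t).
  by move=> h; rewrite /f /concat h; have [] := pA (2*t).
have fX2 t : 2^-1 < t -> X2 (f t).
  by move=> h; rewrite /f /concat leNgt h; have [] := qA (2*t - 1).
have UW x : A x -> U x -> ~ W x.
  by move=> Ax Ux Wx; exact: (AK x) (split_disjoint XS (conj Ux Wx)).
have fhalf : f 2^-1 = w.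
  by rewrite /f /concat lexx mulfV ?p1// pnatr_eq0.
exists f; split => //; first by rewrite /f concat0 concat1 p0.
(* The second half lies in copy 1 of [X2]; at its points of [W] the index is counted in [X1], hence
   is 0. *)
pose N t : int := if (t <= 2^-1) || `[< W (f t) >] then 0 else 1.
exists N; last first.
  rewrite /N (_ : (1 <= 2^-1) = false)/=; last by apply/negP; lra.
  rewrite invr_ge0 ler0n/= asboolF ?subr0// /f concat1 q1.
  by apply: UW => //; rewrite -q1; have [] := qA 1.
have near_notin B t : closed (K `|` B) -> ~ B (f t) ->
    \forall t' \near t, ~ B (f t').
  move=> cB nB.
  have nKB : ~ (K `|` B) (f t) by case=> // /AK; apply; exact: fA.
  have := within_continuous_near_notin (D := setT) (continuous_subspaceT cf) I
    cB nKB.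
  by apply: filterS => t' /(_ I) h Bt'; apply: h; right.
have nearW t : ~ W (f t) -> \forall t' \near t, ~ W (f t').
  exact/near_notin/(split_closedW XS).
have nearU t : ~ U (f t) -> \forall t' \near t, ~ U (f t').
  exact/near_notin/(split_closedU XS).
move=> t _; have [Wt|nWt] := pselect (W (f t)).
  right; have nU : ~ U (f t) by move=> Ut; exact: (UW (f t)).
  (* Off [U], a point of the second half that lies in [X1] must lie in [W], so the index equals
     [side]. *)
  have NW t' : ~ U (f t') -> N t' - side X1 (f t') = 0.
    move=> nU'; rewrite /N /side; have [h|h] := leP t' 2^-1.
      by rewrite /= asboolT ?subrr//; exact: fX1.
    rewrite /=; case: asboolP => [Wt'|nW'].
      by rewrite asboolT ?subrr//; exact: WX1.
    rewrite asboolF ?subrr// => h1.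
    have [/AK|[]//] := split_meet XS (conj h1 (fX2 _ h)).
    by apply; exact: fA.
  by apply: filterS (nearU _ nU) => t' nU' _; rewrite !NW.
left; have [t2|t2|t2] := ltgtP t 2^-1.
- have h : \forall t' \near t, t' < 2^-1.
    by apply: open_nbhs_nbhs; split => //; exact: open_lt.
  apply: filterS2 h (nearW _ nWt) => t' h nW' _; split=> //.
  by rewrite /N (ltW h) (ltW t2).
- have h : \forall t' \near t, 2^-1 < t'.
    by apply: open_nbhs_nbhs; split => //; exact: open_gt.
  apply: filterS2 h (nearW _ nWt) => t' h nW' _; split=> //.
  by rewrite /N !leNgt h t2 /= !asboolF.
(* The jump of [N] at the midpoint is harmless: [f] takes the value [w] there, which lies in [W]. *)
- by move: nWt; rewrite t2 fhalf.
Qed.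

End Paths.
(** * Locally finite CW-complexes *)

Lemma finite_bigcup_ind (T I : Type) (P : set T -> Prop) (D : set I)
    (F : I -> set T) :
  P set0 -> (forall A B, P A -> P B -> P (A `|` B)) -> finite_set D ->
  (forall i, D i -> P (F i)) -> P (\bigcup_(i in D) F i).
Proof.
elim/Pchoice: I D F => I D F P0 PU /finite_seqP[s ->] PF.
by rewrite bigcup_seq big_seq; apply: big_ind.
Qed.

Section Disk.
Context (R : realType) (n : nat).

Let sqr_continuous : continuous (fun x : R => x ^+ 2).
Proof. by move=> x; exact: exprn_continuous. Qed.

Lemma compact_disk : compact (disk R n).
Proof.
have cB := @rV_compact R n (fun=> `[- 1, 1]%classic)
  (fun=> @segment_compact R (- 1) 1).
apply: (subclosed_compact _ cB).
  apply: (@closed_comp _ _ (fun x : 'rV[R]_n => \sum_i x 0 i ^+ 2)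
    [set y | y <= 1]).
    by move=> x _; exact: (sum_coord_continuous sqr_continuous).
  exact: closed_le.
move=> x x1 i /=; rewrite in_itv/= -ler_norml -(@ler_pXn2r _ 2) ?nnegrE//.
rewrite expr1n real_normK ?num_real//.
apply: le_trans x1; rewrite (bigD1 i)//= lerDl.
by apply: sumr_ge0 => j _; exact: sqr_ge0.
Qed.

Lemma open_disk_subset : open_disk R n `<=` disk R n.
Proof. by move=> x /ltW. Qed.

Lemma open_disk_scale x t : 0 <= t < 1 -> disk R n x -> open_disk R n (t *: x).
Proof.
move=> /andP[t0 t1]; rewrite /disk /open_disk /= => x1.
under eq_bigr => i _ do rewrite mxE exprMn.
rewrite -mulr_sumr; apply: (@le_lt_trans _ _ (t ^+ 2)).
  by rewrite ler_piMr ?sqr_ge0.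
by rewrite expr_lt1.
Qed.

End Disk.

Section Cells.
Context (R : realType) (X : topologicalType) (S : cw_structure R X).
Implicit Types (e : cell S) (A B K L Y : set X).

Lemma open_cell_subset e : open_cell e `<=` closed_cell e.
Proof. exact/image_subset/open_disk_subset. Qed.

Lemma closed_cell_compact e : compact (closed_cell e).
Proof.
by apply: continuous_compact; [exact: char_map_continuous|exact: compact_disk].
Qed.

Lemma closed_cell_closed e : closed (closed_cell e).
Proof. exact: compact_closed (cw_hausdorff S) (@closed_cell_compact e). Qed.

Lemma closure_open_cell e : closure (open_cell e) `<=` closed_cell e.
Proof.
move=> x /(closureS (@open_cell_subset e)); exact: closed_cell_closed.
Qed.

Lemma cell_cover x : exists e : cell S, open_cell e x.
Proof.
have [+ _ _] := cw_partition S; rewrite /cover => h.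
have : [set: X] x by [].
by rewrite -h => -[e _ ex]; exists e.
Qed.

Lemma open_cell_inj e e' x : open_cell e x -> open_cell e' x -> e = e'.
Proof.
by have [_ + _] := cw_partition S => h ex e'x; apply: h => //; exists x.
Qed.

(** The radius to the centre of the disk enters the open disk at once, so its image stays in the
    open cell after [x]. The parameter is clamped by [c] to give a path on the whole line. *)
Lemma closed_cell_joined e x A : closed_cell e x ->
  open_cell e `<=` A -> A x -> joined R A x (char_map S e 0).
Proof.
move=> [d dD <-] eA Ax.
pose c (t : R) : R := Num.max 0 (Num.min 1 t).
have c01 t : 0 <= c t <= 1 by rewrite /c le_max ge_max ge_min !lexx ler01.
have cc : continuous c.
  move=> t; apply: continuous_max; first exact: cvg_cst.
  by apply: continuous_min; [exact: cvg_cst|exact: cvg_id].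
pose h (t : R) : 'rV[R]_(cell_dim e) := (1 - c t) *: d.
have ch : continuous h.
  move=> t; apply: (@cvgZr_tmp _ _ _ (nbhs t)).
  by apply: cvgB; [exact: cvg_cst|exact: cc].
have hD t : disk R _ (h t).
  have /andP[c0 c1] := c01 t; have [c0'|cn] := eqVneq (c t) 0.
    by rewrite /h c0' subr0 scale1r.
  apply/open_disk_subset/open_disk_scale => //.
  by rewrite subr_ge0 c1 gtrBl lt_neqAle eq_sym cn.
exists (fun t => char_map S e (h t)); split.
- move=> t B /= nB.
  have H : \forall t' \near t, disk R _ (h t') -> B (char_map S e (h t')).
    exact: (ch t _ (within_continuous_near
      (@char_map_continuous R X S e) (hD t) nB)).
  by apply: filterS H => t'; apply; exact: hD.
- move=> t; have /andP[c0 c1] := c01 t; have [c0'|cn] := eqVneq (c t) 0.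
    by rewrite /h c0' subr0 scale1r.
  apply: eA; exists (h t) => //; apply: open_disk_scale => //.
  by rewrite subr_ge0 c1 gtrBl lt_neqAle eq_sym cn.
- by rewrite /h /c min_r ?ler01// maxxx subr0 scale1r.
- by rewrite /h /c minxx max_r ?ler01// subrr scale0r.
Qed.

(** Says that [A] is a union of open cells; unlike being a subcomplex, this survives set
    difference. *)
Definition cellular A : Prop :=
  forall e x y, open_cell e x -> open_cell e y -> A x -> A y.

Lemma cellular_sub A e x : cellular A -> open_cell e x -> A x ->
  open_cell e `<=` A.
Proof. by move=> cA ex Ax y ey; exact: cA ex ey Ax. Qed.

Lemma cellularI A B : cellular A -> cellular B -> cellular (A `&` B).
Proof.
move=> cA cB e x y ex ey [Ax Bx].
by split; [exact: cA ex ey Ax|exact: cB ex ey Bx].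
Qed.

Lemma cellularC A : cellular A -> cellular (~` A).
Proof. by move=> cA e x y ex ey nA Ay; apply: nA; exact: cA ey ex Ay. Qed.

Lemma cellularD A B : cellular A -> cellular B -> cellular (A `\` B).
Proof.
by move=> cA cB; rewrite setDE; apply: cellularI => //; exact: cellularC.
Qed.

Lemma subcomplex_cellular A : subcomplex S A -> cellular A.
Proof.
move=> [F [-> _]] e x y ex ey [e' Fe' e'x].
by exists e' => //; rewrite -(open_cell_inj ex e'x).
Qed.

Lemma finite_subcomplex_subcomplex A : finite_subcomplex S A -> subcomplex S A.
Proof. by move=> [F _ h]; exists F. Qed.

Lemma cellular_open_cell_joined A e x y : cellular A ->
  open_cell e x -> open_cell e y -> A x -> joined R A x y.
Proof.
move=> cA ex ey Ax; have eA := cellular_sub cA ex Ax.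
apply: (joined_trans (y := char_map S e 0)).
  by apply: closed_cell_joined => //; exact: open_cell_subset.
by apply/joined_sym/closed_cell_joined => //;
  [exact: open_cell_subset|exact: eA].
Qed.

Hypothesis lfS : locally_finite S.

(** Near [x] only finitely many cells of [A] occur, and the union of their closures is closed. *)
Lemma cellular_closure A x : cellular A -> closure A x ->
  exists2 e : cell S, open_cell e `<=` A & closure (open_cell e) x.
Proof.
move=> cA clA; have [V nV fV] := lfS x.
pose F := [set e : cell S | V `&` open_cell e !=set0] `&`
  [set e : cell S | open_cell e `<=` A].
apply: contrapT => h.
have cF : closed (\bigcup_(e in F) closure (open_cell e)).
  apply: finite_bigcup_ind.
  - exact: closed0.
  - by move=> ? ? ? ?; exact: closedU.
  - exact: finite_setIl.
  - by move=> e _; exact: closed_closure.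
have nF : nbhs x (~` \bigcup_(e in F) closure (open_cell e)).
  apply: open_nbhs_nbhs; split; first exact: closed_openC.
  by move=> [e [_ eA] ex]; apply: h; exists e.
have [y [Ay [Vy nFy]]] := clA _ (filterI nV nF).
have [e ey] := cell_cover y; apply: nFy; exists e; last exact: subset_closure.
by split; [exists y|exact: cellular_sub ey Ay].
Qed.

Lemma subcomplex_closed A : subcomplex S A -> closed A.
Proof.
move=> sA x /(cellular_closure (subcomplex_cellular sA))[e eA].
move=> /closure_open_cell ex; move: sA eA => [F [AE FA]] eA.
have [y ey] : open_cell e !=set0 by have [_ _] := cw_partition S; apply.
have := eA y ey; rewrite AE => -[e' Fe' e'y].
by rewrite -AE; apply: (FA e) => //; rewrite (open_cell_inj ey e'y).
Qed.

Lemma finite_subcomplex_compact K : finite_subcomplex S K -> compact K.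
Proof.
move=> [F fF [KE FK]].
have -> : K = \bigcup_(e in F) closed_cell e.
  rewrite eqEsubset; split=> [|x [e Fe]]; last exact: FK.
  by rewrite KE => x [e Fe ex]; exists e => //; exact: open_cell_subset.
apply: finite_bigcup_ind => //.
- exact: compact0.
- by move=> *; exact: compactU.
- by move=> e _; exact: closed_cell_compact.
Qed.

Lemma finite_subcomplex0 : finite_subcomplex S set0.
Proof. by exists set0 => //; split => //; rewrite bigcup_set0. Qed.

Lemma finite_subcomplexU K L : finite_subcomplex S K ->
  finite_subcomplex S L -> finite_subcomplex S (K `|` L).
Proof.
move=> [F fF [KE FK]] [G fG [LE GL]]; exists (F `|` G).
  by rewrite finite_setU.
split; first by rewrite bigcup_setU -KE -LE.
by move=> e [/FK|/GL] h x /h; [left|right].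
Qed.

Lemma finite_subcomplexI K Y : finite_subcomplex S K -> subcomplex S Y ->
  finite_subcomplex S (K `&` Y).
Proof.
move=> [F fF [KE FK]] [G [YE GY]]; exists (F `&` G).
  exact: finite_setIl.
split; last by move=> e [/FK h /GY h'] x ex; split; [exact: h|exact: h'].
rewrite eqEsubset; split=> x.
  rewrite KE YE => -[[e Fe ex] [e' Ge' e'x]]; exists e => //; split => //.
  by rewrite (open_cell_inj ex e'x).
move=> [e [Fe Ge] ex]; split; [rewrite KE|rewrite YE]; by exists e.
Qed.

Definition bounded_in Y A : Prop :=
  exists M, [/\ finite_subcomplex S M, M `<=` Y & A `<=` M].

Lemma bounded_in_bigcup Y (I : Type) (D : set I) (F : I -> set X) :
  finite_set D -> (forall i, D i -> bounded_in Y (F i)) ->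
  bounded_in Y (\bigcup_(i in D) F i).
Proof.
move=> fD; apply: finite_bigcup_ind => //.
  by exists set0; split=> //; exact: finite_subcomplex0.
move=> A B [M [fM MY AM]] [N [fN NY BN]]; exists (M `|` N).
by split; [exact: finite_subcomplexU|rewrite subUset|exact: setUSS].
Qed.

(** Induction on the dimension: the boundary lies in finitely many cells of lower dimension, hence
    in a finite subcomplex, to which the open cell is added. *)
Lemma closed_cell_bounded e : bounded_in setT (closed_cell e).
Proof.
have [n] := ubnP (cell_dim e); elim: n e => // n IH e.
rewrite ltnS => en; have [F [fF Fdim sF]] := cw_closure_finite e.
have [M [fM _ FM]] : bounded_in setT (\bigcup_(e' in F) closed_cell e').
  apply: bounded_in_bigcup => // e' /Fdim e'e; apply: IH.
  exact: leq_trans e'e en.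
have eM : closed_cell e `<=` open_cell e `|` M.
  move=> _ [d dD <-]; have [d1|d1] := pselect (open_disk R _ d).
    by left; exists d.
  right; apply: FM; have [|e' Fe' h] := sF (char_map S e d).
    exists d => //; apply/eqP; rewrite eq_le.
    by rewrite dD leNgt; apply/negP => /d1.
  by exists e' => //; exact: open_cell_subset.
exists (open_cell e `|` M); split => //.
move: fM => [G fG [ME GM]]; exists (e |` G).
  by rewrite finite_setU; split => //; exact: finite_set1.
split; first by rewrite bigcup_setU1 -ME.
by move=> e' [->|/GM h] // x /h; right.
Qed.

(** The finite set controls a neighbourhood of each point of [A], so that it also catches cells
    whose closure merely touches [A]. *)
Lemma compact_meets_finite A : compact A ->
  exists2 E : set (cell S), finite_set E &
    forall x, A x -> \forall y \near x, forall e, open_cell e y -> E e.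
Proof.
move=> /compact_near_coveringP cA.
(* Along this filter a variable set of cells eventually contains any given finite set; compactness
   then yields one finite set for all of [A]. *)
pose F : set_system (set (cell S)) :=
  filter_from (@finite_set _) (fun E0 => [set E | E0 `<=` E]).
have FF : Filter F.
  apply: filter_from_filter; first by exists set0; exact: finite_set0.
  move=> E E' fE fE'; exists (E `|` E'); first by rewrite finite_setU.
  by move=> G EG; split=> e h; apply: EG; [left|right].
have [x Ax|E fE EA] := cA _ F
  (fun E x => \forall y \near x, forall e, open_cell e y -> E e) FF.
  have [V nV fV] := lfS x.
  exists (V°, [set E | [set e : cell S | V `&` open_cell e !=set0] `<=` E]).
    split; first exact: nbhs_interior.
    by exists [set e : cell S | V `&` open_cell e !=set0].
  move=> [y E] /= [Vy VE]; apply: filterS Vy => z Vz e ez.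
  by apply: VE; exists z.
by exists E => //; apply: EA.
Qed.

Lemma compact_bounded_in A : compact A -> bounded_in setT A.
Proof.
move=> /compact_meets_finite[E fE EA].
have [M [fM MT EM]] : bounded_in setT (\bigcup_(e in E) closed_cell e).
  by apply: bounded_in_bigcup => // e _; exact: closed_cell_bounded.
exists M; split=> // x Ax; have [e ex] := cell_cover x.
apply: EM; exists e; last exact: open_cell_subset.
exact: (nbhs_singleton (EA x Ax)).
Qed.

Lemma compact_closure_meets_finite A : compact A ->
  finite_set [set e : cell S | closure (open_cell e) `&` A !=set0].
Proof.
move=> /compact_meets_finite[E fE EA]; apply: sub_finite_set fE.
by move=> e [x [ex /EA]] /ex[y [ey h]]; exact: h.
Qed.

(** Says that [B] is a union of path components of [A]. *)
Definition saturated A B : Prop :=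
  B `<=` A /\ forall x y, B x -> joined R A x y -> B y.

Lemma saturatedD A B : saturated A B -> saturated A (A `\` B).
Proof.
move=> [BA hB]; split=> [x []//|x y [Ax nBx] xy]; split.
  by have [g [_ gA _ <-]] := xy; exact: gA.
by move=> By; apply: nBx; apply: hB By _; exact: joined_sym.
Qed.

Lemma saturated_cellular A B : cellular A -> saturated A B -> cellular B.
Proof.
move=> cA [BA hB] e x y ex ey Bx; apply: (hB x) => //.
exact: cellular_open_cell_joined cA ex ey (BA _ Bx).
Qed.

(** A limit point in [A] lies in the closure of a single cell of [B], and a radial path joins it to
    that cell within [A]. *)
Lemma saturated_closure A B : cellular A -> saturated A B ->
  A `&` closure B `<=` B.
Proof.
move=> cA sB x [Ax /(cellular_closure (saturated_cellular cA sB))[e eB ex]].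
move: sB => [BA hB].
have [y ey] : open_cell e !=set0 by have [_ _] := cw_partition S; apply.
apply: (hB y); first exact: eB.
apply: (joined_trans (y := char_map S e 0)).
  apply: closed_cell_joined; first exact: open_cell_subset.
    exact: subset_trans eB BA.
  exact/BA/eB.
apply/joined_sym/closed_cell_joined => //; first exact: closure_open_cell.
exact: subset_trans eB BA.
Qed.

(** The rest of [A] is saturated too, hence relatively closed. *)
Lemma saturated_near A B x : cellular A -> saturated A B -> B x ->
  \forall y \near x, A y -> B y.
Proof.
move=> cA sB Bx.
have nx : ~ closure (A `\` B) x.
  move=> cx; have [Ax BA] := (sB.1 x Bx, sB.1).
  by have [_] := saturated_closure cA (saturatedD sB) (conj Ax cx).
have : nbhs x (~` closure (A `\` B)).
  by apply: open_nbhs_nbhs; split => //; exact/closed_openC/closed_closure.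
apply: filterS => y ny Ay; apply: contrapT => nBy.
by apply: ny; apply: subset_closure.
Qed.

Lemma joined_component A x y : joined R A x y -> connected_component A x y.
Proof.
move=> [g [cg gA g0 g1]]; exists (g @` `[0, 1]).
  split.
  - by exists 0 => //; rewrite /= in_itv/= lexx ler01.
  - by move=> _ [t _ <-]; exact: gA.
  - apply: connected_continuous_connected; first exact: segment_connected.
    exact: continuous_subspaceT.
by exists 1 => //; rewrite /= in_itv/= lexx ler01.
Qed.

(** The path component of [x] and its complement in [A] are both relatively open, so membership is
    locally constant on the connected component. *)
Lemma component_joined A x y : cellular A -> connected_component A x y ->
  joined R A x y.
Proof.
move=> cA xy; have CA := @connected_component_sub _ A x.
have Ax : A x.
  by apply: contrapT => /connected_component_out E; rewrite E in xy.
have sP : saturated A (joined R A x).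
  split=> [z [g [_ gA _ <-]]//|z w]; exact: joined_trans.
suff : joined R A x x = joined R A x y.
  by move=> <-; exact: joined_refl.
apply: (@locally_constant_connected _ _ (connected_component A x)
  (fun z => joined R A x z)) => //.
- exact: component_connected.
- move=> t /CA At; have [xt|nxt] := pselect (joined R A x t).
    apply: filterS (saturated_near cA sP xt) => t' h /CA At'.
    by apply/propext; split => // _; exact: h.
  apply: filterS (saturated_near cA (saturatedD sP) (conj At nxt)).
  by move=> t' h /CA /h[_ nt']; apply/propext.
- exact: connected_component_refl.
Qed.

Lemma component_saturated A x : cellular A ->
  saturated A (connected_component A x).
Proof.
move=> cA; split; first exact: connected_component_sub.
by move=> y z xy /joined_component; exact: connected_component_trans.
Qed.

Lemma saturated_closed Z K B : closed Z -> closed K -> cellular (Z `\` K) ->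
  saturated (Z `\` K) B -> closed (K `|` B).
Proof.
move=> cZ cK cA sB x; rewrite closureU => -[/cK|cx]; first by left.
have [Kx|nKx] := pselect (K x); [by left|right].
apply: (saturated_closure cA sB); split=> //; split=> //.
by apply: cZ; apply: closureS cx => y /sB.1[].
Qed.

End Cells.

(** * Joining distant points of a one-ended subcomplex *)

Section Ends.
Context (R : realType) (X : topologicalType) (S : cw_structure R X).
Hypothesis lfS : locally_finite S.

(** The subcomplex [M] absorbs the bounded components of [Y] minus [L] that contain points of a cell
    whose closure touches [L]; there are finitely many such cells. *)
Lemma one_ended_joined (Y L : set X) :
  subcomplex S Y -> connected Y -> one_ended S Y -> finite_subcomplex S L ->
  exists2 M, finite_subcomplex S M &
    forall x y, (Y `\` (L `|` M)) x -> (Y `\` (L `|` M)) y ->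
      joined R (Y `\` L) x y.
Proof.
move=> sY cY oY fL; pose A := Y `\` L.
have sL := finite_subcomplex_subcomplex fL.
have cA : cellular S A by apply: cellularD; exact: subcomplex_cellular.
(* One-endedness speaks of finite subcomplexes inside [Y], so it is applied to the trace of [L] on
   [Y]. *)
have AE : Y `\` (L `&` Y) = A by rewrite setDIr setDv setU0.
have [E [[[x0 Ax0 EE] _] Euniq]] :=
  oY _ (finite_subcomplexI fL sY) (@subIsetr _ _ _).
rewrite AE in Ax0 EE Euniq.
pose C := connected_component A.
(* An open cell meeting [A] lies in one component of [A], so [B e] is empty or a single component
   other than [E]; by uniqueness of [E] it is bounded. *)
pose B (e : cell S) :=
  \bigcup_(y in open_cell e `&` A `&` [set y | C y <> E]) C y.
have [e _|M [fM MY BM]] := bounded_in_bigcup (S := S) (Y := Y) (F := B)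
  (compact_closure_meets_finite lfS (finite_subcomplex_compact fL)).
  have [[y [[ey Ay] CyE]]|nB] :=
      pselect (open_cell e `&` A `&` [set y | C y <> E] !=set0); last first.
    exists set0; split=> //; first exact: finite_subcomplex0.
    by move=> x [y hy]; case: nB; exists y.
  have [M [fM MY CM]] : bounded_in S Y (C y).
    apply: contrapT => ub; apply: CyE; apply/esym; apply: Euniq.
    by split=> //; exists y.
  exists M; split=> // x [z [[ez Az] _] Cz]; apply: CM.
  apply: connected_component_trans Cz; apply: joined_component.
  exact: cellular_open_cell_joined cA ey ez Ay.
exists M => //.
(* A component of Y - L other than E either lies in M or has closure disjoint
   from L; in the latter case it is clopen in Y, hence all of Y, and meets E. *)
suff CE z : (Y `\` (L `|` M)) z -> C z = E.
  move=> x y hx hy; apply: (component_joined lfS cA).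
  have [Yy nLMy] := hy.
  have Ay : A y by split=> // Ly; apply: nLMy; left.
  by rewrite -/(C x) (CE x hx) -(CE y hy); exact: connected_component_refl.
move=> [Yz nLMz].
have Az : A z by split=> // Lz; apply: nLMz; left.
have Cz : C z z by exact: connected_component_refl.
have sC := component_saturated (A := A) z cA.
have cC := saturated_cellular cA sC.
apply: contrapT => CzE.
have closCL t : L t -> ~ closure (C z) t.
  move=> Lt /(cellular_closure lfS cC)[e eC et].
  have [y ey] : open_cell e !=set0 by have [_ _] := cw_partition S; apply.
  apply: nLMz; right; apply: BM; exists e; first by exists t.
  have zy := eC y ey; exists y; last exact: connected_component_sym.
  split; first by split=> //; exact: sC.1.
  by rewrite /= /C -(same_connected_component zy).
have nearC t : ~ closure (C z) t -> \forall t' \near t, ~ C z t'.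
  move=> nt; have : nbhs t (~` closure (C z)).
    by apply: open_nbhs_nbhs; split => //; exact/closed_openC/closed_closure.
  by apply: filterS => y ny Cy; apply: ny; exact: subset_closure.
have cL := subcomplex_closed lfS sL.
have YC t : Y t -> C z t.
  move=> Yt; suff <- : C z z = C z t by [].
  apply: (@locally_constant_connected _ _ Y (C z)) => // {t Yt} t Yt.
  have [Ct|nCt] := pselect (C z t).
    have [_ nLt] := sC.1 t Ct.
    have nL : nbhs t (~` L).
      by apply: open_nbhs_nbhs; split => //; exact: closed_openC.
    apply: filterS2 nL (saturated_near lfS cA sC Ct) => t' nLt' h Yt'.
    by apply/propext; split=> // _; exact: h.
  have nt : ~ closure (C z) t.
    have [Lt|nLt] := pselect (L t); first exact: closCL.
    by move=> ct; apply: nCt; apply: (saturated_closure lfS cA sC); split.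
  by apply: filterS (nearC t nt) => t' nCt' _; apply/propext.
have zx0 : C z x0 by apply: YC; case: Ax0.
by apply: CzE; rewrite EE /C (same_connected_component zx0).
Qed.

End Ends.

(** * Loops near infinity from two unbounded components *)

Theorem theorem1p4 (R : realType) (X : topologicalType) (S : cw_structure R X)
    (X1 X2 K : set X) :
  locally_finite S ->
  subcomplex S X1 -> connected X1 -> one_ended S X1 ->
  subcomplex S X2 -> connected X2 -> one_ended S X2 ->
  X1 `|` X2 = [set: X] ->
  finite_subcomplex S K ->
  (exists U V : set X,
    [/\ unbounded_component S [set: X] ((X1 `&` X2) `\` K) U,
        unbounded_component S [set: X] ((X1 `&` X2) `\` K) V &
        U <> V]) ->
  ~ pro_finite_H1_at_infinity R X /\ ~ simply_connected_at_infinity R X.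
Proof.
move=> lfS s1 c1 o1 s2 c2 o2 X12 fK.
move=> [U [V [[[u0 Au0 UE] ubU] [[v0 Av0 VE] ubV] UV]]].
pose A := (X1 `&` X2) `\` K; rewrite -/A in Au0 UE Av0 VE.
have sK := finite_subcomplex_subcomplex fK.
have cl1 := subcomplex_closed lfS s1; have cl2 := subcomplex_closed lfS s2.
have clK := subcomplex_closed lfS sK.
have cA : cellular S A.
  by apply: cellularD; [apply: cellularI|]; exact: subcomplex_cellular.
have sU : saturated R A U by rewrite UE; exact: component_saturated cA.
(* The second piece is all of [A] outside [U], so that the two pieces exhaust [A]; of [V] only its
   unboundedness inside that piece is used. *)
have VW : V `<=` A `\` U.
  rewrite VE => x vx; split; first exact: connected_component_sub vx.
  rewrite UE => ux; apply: UV; rewrite UE VE.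
  by rewrite (same_connected_component ux) (same_connected_component vx).
have XS : split_along X1 X2 K U (A `\` U).
  split => //.
  - move=> x x12; have [Kx|nKx] := pselect (K x); [by left|right].
    by have [Ux|nUx] := pselect (U x); [left|right].
  - by apply: saturated_closed cA sU => //; exact: closedI.
  - by apply: saturated_closed cA (saturatedD sU) => //; exact: closedI.
  - by move=> x [Ux []].
have loops D : compact D ->
    exists f : R -> X, winding_loop X1 U (A `\` U) (~` (D `|` K)) f.
  move=> cD; have [L0 [fL0 _ DL0]] := compact_bounded_in lfS cD.
  have fL := finite_subcomplexU fL0 fK; set L := L0 `|` K in fL.
  have [M1 fM1 h1] := one_ended_joined lfS s1 c1 o1 fL.
  have [M2 fM2 h2] := one_ended_joined lfS s2 c2 o2 fL.
  (* An unbounded set escapes every finite subcomplex, which gives points of [U] and [V] beyond both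
     [M1] and [M2]. *)
  have far (B : set X) : unbounded S setT B ->
      exists2 x, B x & ~ (L `|` (M1 `|` M2)) x.
    move=> ubB; apply: contrapT => h; apply: ubB; exists (L `|` (M1 `|` M2)).
    split => //; first by do 2?apply: finite_subcomplexU.
    by move=> x Bx; apply: contrapT => nx; apply: h; exists x.
  have [u Uu nu] := far U ubU; have [v Vv nv] := far V ubV.
  have [[Xu1 Xu2] nKu] := sU.1 u Uu; have [[[Xv1 Xv2] nKv] nUv] := VW v Vv.
  have n1 x : ~ (L `|` (M1 `|` M2)) x -> ~ (L `|` M1) x.
    by move=> n [?|?]; apply: n; [left|right; left].
  have n2 x : ~ (L `|` (M1 `|` M2)) x -> ~ (L `|` M2) x.
    by move=> n [?|?]; apply: n; [left|right; right].
  have J1 : joined R (X1 `&` ~` L) u v by apply: h1; split => //; exact: n1.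
  have J2 : joined R (X2 `&` ~` L) v u by apply: h2; split => //; exact: n2.
  have LK : ~` L `<=` ~` K by apply: subsetC => x; right.
  have UX1 : U `<=` X1 by move=> x /sU.1[[]].
  have WX1 : A `\` U `<=` X1 by move=> x [[[]]].
  have [f [cf fA f01 hN]] :=
    joined_winding_loop XS LK UX1 WX1 Uu (VW v Vv) J1 J2.
  exists f; split => // t [Dt|Kt]; apply: (fA t); [left; exact: DL0|by right].
have cK := finite_subcomplex_compact fK.
split; [exact: winding_loop_not_pro_finite_H1_at_infinity XS cK loops|].
exact: winding_loop_not_simply_connected_at_infinity XS cK loops.
Qed.
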